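(* Let $A$ be a unital $C^*$-algebra and let $a\in A$ be such that $a^{\dag}$ exists. Then the following statements are equivalent: (i) $a$ is EP; (ii) there exists $s\in A$ such that $s^{-1}(0)=0$ and $a^*=sa$; (iii) there exist $s_1,s_2\in A$ such that $a^*=s_1a$ and $a=s_2a^*$; (iv) there exists $u\in A$ such that $uA=A$ and $a^*=au$; (v) there exist $u_1,u_2\in A$ such that $a^*=au_1$ and $a=a^*u_2$; (vi) there exists $t\in A$ such that $t_{-1}(0)=0$ and $a^*=at$; (vii) there exists $x\in A$ such that $Ax=A$ and $a^*=xa$; (viii) there exists $v\in A^{-1}$ such that $a^*a=vaa^*$; (ix) there exists $v_1\in A$ such that $v_1^{-1}(0)=0$ and $a^*a=v_1aa^*$; (x) there exist $v_2,v_3\in A$ such that $a^*a=v_2aa^*$ and $aa^*=v_3a^*a$; (xi) there exists $w\in A^{-1}$ such that $a^*a=aa^*w$; (xii) there exists $w_1\in A$ such that $w_1A=A$ and $a^*a=aa^*w_1$; (xiii) there exist $w_2,w_3\in A$ such that $a^*a=aa^*w_2$ and $aa^*=a^*aw_3$; (xiv) there exist $z_1,z_2\in A$ such that $a^*a=az_1a^*$ and $aa^*=a^*z_2a$; (xv) there exists $h_1\in A^{-1}$ such that $a^*a=ah_1h_1^*a^*$; (xvi) there exists $h_2\in A$ such that $(h_2)^{-1}(0)=0$ and $a^*a=ah_2h_2^*a^*$; (xvii) there exists $h_3\in A$ such that $h_3A=A$ and $a^*a=ah_3h_3^*a^*$.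
   Context: $A^{-1}$ is the set of invertible elements of $A$. For $x\in A$: $x^{-1}(0)=\{y\in A: xy=0\}$, $x_{-1}(0)=\{y\in A: yx=0\}$, $xA=\{xy:y\in A\}$, $Ax=\{yx:y\in A\}$. The Moore-Penrose inverse of $a\in A$, if it exists, is the (unique) $x\in A$ with $a=axa$, $x=xax$ and $ax$, $xa$ self-adjoint; it is denoted $a^{\dag}$. An element $a$ is EP if $a^{\dag}$ exists and $aa^{\dag}=a^{\dag}a$.
   Formalization: In (xvi) the condition (h_2)^{-1}(0)=0 is replaced by (h_2)_{-1}(0)=0, since as printed (xvi) does not imply (i): for a non-unitary isometry s take a=s^* and h_2=sss^*+(1-ss^* ). *)

(* Defs.v *)
From HB Require Import structures.
From mathcomp Require Import all_boot all_order all_algebra complex.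
From mathcomp Require Import all_classical all_reals all_analysis.

Set Implicit Arguments.
Unset Strict Implicit.
Unset Printing Implicit Defensive.

Import Order.TTheory GRing.Theory Num.Theory.
Import numFieldNormedType.Exports.

Local Open Scope classical_set_scope.
Local Open Scope ring_scope.

(* Unital complex C*-algebras, the zero algebra included (1 != 0 is not          *)
(* required, as it would be for an algType). The norm of a normed module over   *)
(* R[i] takes values in R[i], in its nonnegative reals. The product is a field  *)
(* of the record because the hierarchy of structures has no join of rings and   *)
(* normed modules below numDomainType, and so rejects a structure on top of     *)
(* both; it becomes the ring product of A in the pzRingType instance below.     *)
Record cstarAlgType (R : realType) := CStarAlgType {
  cstar_base : completeNormedModType R[i];
  cstar_one : cstar_base;
  cstar_mul : cstar_base -> cstar_base -> cstar_base;
  cstar_star : cstar_base -> cstar_base;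
  cstar_mulA : associative cstar_mul;
  cstar_mul1l : left_id cstar_one cstar_mul;
  cstar_mul1r : right_id cstar_one cstar_mul;
  cstar_mulDl : left_distributive cstar_mul +%R;
  cstar_mulDr : right_distributive cstar_mul +%R;
  cstar_scaleAl : forall (c : R[i]) x y,
    c *: cstar_mul x y = cstar_mul (c *: x) y;
  cstar_scaleAr : forall (c : R[i]) x y,
    c *: cstar_mul x y = cstar_mul x (c *: y);
  cstar_normM : forall x y, `|cstar_mul x y| <= `|x| * `|y|;
  cstar_starK : involutive cstar_star;
  cstar_starD : {morph cstar_star : x y / x + y};
  cstar_starZ : forall (c : R[i]) x, cstar_star (c *: x) = c^* *: cstar_star x;
  cstar_starM : forall x y,
    cstar_star (cstar_mul x y) = cstar_mul (cstar_star y) (cstar_star x);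
  cstar_norm_star : forall x, `|cstar_mul (cstar_star x) x| = `|x| ^+ 2
}.

Definition cstar_sort (R : realType) (A : cstarAlgType R) : Type :=
  cstar_base A.
Coercion cstar_sort : cstarAlgType >-> Sortclass.

HB.instance Definition _ (R : realType) (A : cstarAlgType R) :=
  CompleteNormedModule.copy (cstar_sort A) (cstar_base A).

HB.instance Definition _ (R : realType) (A : cstarAlgType R) :=
  GRing.Zmodule_isPzRing.Build (cstar_sort A) (@cstar_mulA R A)
    (@cstar_mul1l R A) (@cstar_mul1r R A) (@cstar_mulDl R A) (@cstar_mulDr R A).

Definition star (R : realType) (A : cstarAlgType R) (x : A) : A :=
  cstar_star x.

Section StarTheory.
Context {R : realType} {A : cstarAlgType R}.
Implicit Types x y : A.

Lemma starK : involutive (@star R A).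
Proof. exact: cstar_starK. Qed.

Lemma starD : {morph (@star R A) : x y / x + y}.
Proof. exact: cstar_starD. Qed.

Lemma starZ (c : R[i]) x : star (c *: x) = c^* *: star x.
Proof. exact: cstar_starZ. Qed.

Lemma starM x y : star (x * y) = star y * star x.
Proof. exact: cstar_starM. Qed.

Lemma normM_le x y : `|x * y| <= `|x| * `|y|.
Proof. exact: cstar_normM. Qed.

Lemma norm_star x : `|star x * x| = `|x| ^+ 2.
Proof. exact: cstar_norm_star. Qed.

End StarTheory.

Section Elements.
Context {R : realType} {A : cstarAlgType R}.
Implicit Types a x : A.

(* GRing.unit is not available: a C*-algebra has no canonical unitRingType      *)
(* structure.                                                                   *)
Definition invertible x : Prop := exists y : A, x * y = 1 /\ y * x = 1.

(* x^{-1}(0) *)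
Definition rann x : set A := [set y | x * y = 0].

(* x_{-1}(0) *)
Definition lann x : set A := [set y | y * x = 0].

(* xA *)
Definition rideal x : set A := range (fun y : A => x * y).

(* Ax *)
Definition lideal x : set A := range (fun y : A => y * x).

Definition selfadjoint x : Prop := star x = x.

Definition is_MPinverse a x : Prop :=
  [/\ a = a * x * a, x = x * a * x, selfadjoint (a * x) & selfadjoint (x * a)].

Definition EP a : Prop := exists x : A, is_MPinverse a x /\ a * x = x * a.

End Elements.

(* Main.v *)
(* Let p = a a^+ and q = a^+ a, the projections onto the ranges of a and a^*.   *)
(* Then a is EP iff p = q, i.e. iff a and a^* have the same left (or the same   *)
(* right) annihilator, and each of the conditions forces this; those involving  *)
(* a^* a and a a^* do so because the C*-identity gives a^* a and a the same     *)
(* right annihilator, a a^* and a the same left one. Conversely, if p = q then  *)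
(* a, a^*, a a^* and a^* a are invertible in the corner p A p, and elements     *)
(* invertible there extend to invertible elements of A by adding 1 - p.         *)

Require Import Defs.
From HB Require Import structures.
From mathcomp Require Import all_boot all_order all_algebra complex.
From mathcomp Require Import all_classical all_reals all_analysis.

Set Implicit Arguments.
Unset Strict Implicit.
Unset Printing Implicit Defensive.

Import Order.TTheory GRing.Theory Num.Theory.
Import numFieldNormedType.Exports.

Local Open Scope classical_set_scope.
Local Open Scope ring_scope.

Section CStar.
Context {R : realType} {A : cstarAlgType R}.
Implicit Types a b c h p s x y z : A.

(** The conditions are proved in one cycle. A condition either weakens directly to the next, or its
    factors show that [a] and [star a] have the same annihilator on one side, so that [a] is EP
    ([rann_eq_EP], [lann_eq_EP]); EP then supplies the next condition with invertible factors. These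
    factors come from [corner_associates]: two elements invertible in the same corner pAp are
    associates in A, on both sides. *)

Lemma star0 : star (0 : A) = 0.
Proof. by apply: (addrI (star (0 : A))); rewrite -starD !addr0. Qed.

Lemma star_mul_eq0 x : star x * x = 0 -> x = 0.
Proof.
move=> xx0; apply/eqP; rewrite -normr_eq0 -sqrf_eq0.
by rewrite -norm_star xx0 normr0.
Qed.

Lemma mul_star_eq0 x : x * star x = 0 -> x = 0.
Proof.
rewrite -{1}[x]starK => /star_mul_eq0 x0.
by rewrite -[x]starK x0 star0.
Qed.

(** The C*-identity applies to [a * y], since [star y * (star a * a * y)] is
    [star (a * y) * (a * y)]. *)
Lemma mul_star_mul_eq0 a y : star a * a * y = 0 <-> a * y = 0.
Proof.
split=> [aay0|ay0]; last by rewrite -mulrA ay0 mulr0.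
by apply: star_mul_eq0; rewrite starM -mulrA (mulrA (star a)) aay0 mulr0.
Qed.

Lemma mul_mul_star_eq0 a y : y * (a * star a) = 0 <-> y * a = 0.
Proof.
split=> [yaa0|ya0]; last by rewrite mulrA ya0 mul0r.
by apply: mul_star_eq0; rewrite starM mulrA -(mulrA y) yaa0 mul0r.
Qed.

Lemma rann0P s : rann s = [set 0] <-> forall y, s * y = 0 -> y = 0.
Proof.
split=> [s0 y sy0|s0]; first by have : rann s y by []; rewrite s0.
by apply/seteqP; split=> y /=; [exact: s0 | move=> ->; exact: mulr0].
Qed.

Lemma lann0P s : lann s = [set 0] <-> forall y, y * s = 0 -> y = 0.
Proof.
split=> [s0 y sy0|s0]; first by have : lann s y by []; rewrite s0.
by apply/seteqP; split=> y /=; [exact: s0 | move=> ->; exact: mul0r].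
Qed.

Lemma ridealTP s : rideal s = [set: A] <-> exists y, s * y = 1.
Proof.
split=> [sT|[y sy]]; first by have : rideal s 1; [rewrite sT | case=> y _; exists y].
by apply/seteqP; split=> // z _; exists (y * z) => //; rewrite mulrA sy mul1r.
Qed.

Lemma lidealTP s : lideal s = [set: A] <-> exists y, y * s = 1.
Proof.
split=> [sT|[y sy]]; first by have : lideal s 1; [rewrite sT | case=> y _; exists y].
by apply/seteqP; split=> // z _; exists (z * y) => //; rewrite -mulrA sy mulr1.
Qed.

Lemma lidealT_rann s : lideal s = [set: A] -> rann s = [set 0].
Proof.
by move=> /lidealTP[x xs]; apply/rann0P => y sy; rewrite -[y]mul1r -xs -mulrA sy mulr0.
Qed.

Lemma ridealT_lann s : rideal s = [set: A] -> lann s = [set 0].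
Proof.
by move=> /ridealTP[x sx]; apply/lann0P => y ys; rewrite -[y]mulr1 -sx mulrA ys mul0r.
Qed.

Lemma invertible_rideal s : invertible s -> rideal s = [set: A].
Proof. by move=> [y [sy _]]; apply/ridealTP; exists y. Qed.

Lemma invertible_lideal s : invertible s -> lideal s = [set: A].
Proof. by move=> [y [_ ys]]; apply/lidealTP; exists y. Qed.

Lemma invertible_rann s : invertible s -> rann s = [set 0].
Proof. by move=> /invertible_lideal/lidealT_rann. Qed.

Lemma invertible_lann s : invertible s -> lann s = [set 0].
Proof. by move=> /invertible_rideal/ridealT_lann. Qed.

(** Both [a * x] and [x * a] equal [x * a * a * x]. *)
Lemma MP_EP a x : is_MPinverse a x -> x * a * a = a -> a * (a * x) = a -> EP a.
Proof.
move=> ax xaa aax; exists x; split=> //.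
by rewrite -[in LHS]xaa -[in RHS]aax !mulrA.
Qed.

(** [1 - x * a] is annihilated by [a], and [1 - a * x] by [star a]. Exchanging the two annihilators
    gives the hypotheses of [MP_EP], the former after taking adjoints. *)
Lemma rann_eq_EP a : (exists x, is_MPinverse a x) ->
  (forall y, a * y = 0 <-> star a * y = 0) -> EP a.
Proof.
move=> [x ax] ann; have [axa _ sax sxa] := ax.
apply: (MP_EP ax).
  have /ann : a * (1 - x * a) = 0 by rewrite mulrBr mulr1 mulrA -axa subrr.
  rewrite mulrBr mulr1 => /subr0_eq /(congr1 (@star R A)).
  by rewrite starM starK sxa.
have /ann : star a * (1 - a * x) = 0.
  by rewrite mulrBr mulr1 -sax -starM -axa subrr.
by rewrite mulrBr mulr1 => /subr0_eq.
Qed.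

Lemma lann_eq_EP a : (exists x, is_MPinverse a x) ->
  (forall y, y * a = 0 <-> y * star a = 0) -> EP a.
Proof.
have star_eq0 z : star z = 0 <-> z = 0.
  by split=> [z0|->]; rewrite ?star0 // -[z]starK z0 star0.
move=> a_MP ann; apply: rann_eq_EP => // y.
by rewrite -[X in X <-> _]star_eq0 -[X in _ <-> X]star_eq0 !starM starK ann.
Qed.

(** Mutual inverses in the corner pAp, whose unit is p; the equations force p to be idempotent. *)
Definition corner_inverse p x y : Prop :=
  [/\ x * y = p, y * x = p, p * x = x /\ x * p = x & p * y = y /\ y * p = y].

Lemma corner_inverseC p x y : corner_inverse p x y -> corner_inverse p y x.
Proof. by case. Qed.

Lemma corner_inverseM p x y b c : corner_inverse p x y ->
  corner_inverse p b c -> corner_inverse p (x * b) (c * y).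
Proof.
move=> [xy yx [px xp] [py yp]] [bc cb [pb bp] [pc cp]]; split.
- by rewrite mulrA -(mulrA x) bc xp.
- by rewrite mulrA -(mulrA c) yx cp.
- by rewrite mulrA px -mulrA bp.
- by rewrite mulrA pc -mulrA yp.
Qed.

Lemma corner_inverse_star p x y : selfadjoint p ->
  corner_inverse p x y -> corner_inverse p (star x) (star y).
Proof.
move=> sp [xy yx [px xp] [py yp]].
by split; [..|split|split]; rewrite -1?[in LHS]sp -starM ?xy ?yx ?px ?xp ?py ?yp.
Qed.

(** Block-diagonal picture: x on the corner of p, the identity on that of [1 - p]. *)
Lemma corner_invertible p x y :
  corner_inverse p x y -> invertible (x + (1 - p)).
Proof.
suff inv b c : corner_inverse p b c -> (b + (1 - p)) * (c + (1 - p)) = 1.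
  by move=> xy; exists (y + (1 - p)); split; apply: inv => //; exact: corner_inverseC.
move=> [bc _ [pb bp] [pc _]].
have pp : p * p = p by rewrite -{2}bc mulrA pb.
rewrite mulrDl !mulrDr bc !mulrN !mulr1 bp subrr addr0.
by rewrite !mulrBl !mul1r pc pp !subrr subr0 add0r addrC subrK.
Qed.

(** In the corner, c = (c b') b = b (b' c); adding [1 - p] makes these factors invertible in A
    without changing the products, as [1 - p] kills b. *)
Lemma corner_associates p b b' c c' :
  corner_inverse p b b' -> corner_inverse p c c' ->
  (exists v, invertible v /\ c = v * b) /\ (exists w, invertible w /\ c = b * w).
Proof.
move=> bb' cc'; have [bb'p b'bp [pb bp] _] := bb'; have [_ _ [pc cp] _] := cc'.
split.
  exists (c * b' + (1 - p)); split.
    exact: corner_invertible (corner_inverseM cc' (corner_inverseC bb')).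
  by rewrite mulrDl -mulrA b'bp cp mulrBl mul1r pb subrr addr0.
exists (b' * c + (1 - p)); split.
  exact: corner_invertible (corner_inverseM (corner_inverseC bb') cc').
by rewrite mulrDr mulrA bb'p pc mulrBr mulr1 bp subrr addr0.
Qed.

Lemma EP_corner a : EP a -> exists p x, selfadjoint p /\ corner_inverse p a x.
Proof.
move=> [x [[axa xax sax sxa] axC]]; exists (a * x), x; do !split => //.
- by rewrite axC mulrA -axa.
- by rewrite axC -xax.
- by rewrite mulrA -xax.
Qed.

Lemma EP_star_associates a : EP a ->
  (exists v, invertible v /\ star a = v * a) /\
  (exists w, invertible w /\ star a = a * w).
Proof.
move=> /EP_corner[p [x [sp ax]]].
exact: corner_associates ax (corner_inverse_star sp ax).
Qed.

Lemma EP_normal_associates a : EP a ->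
  (exists v, invertible v /\ star a * a = v * (a * star a)) /\
  (exists w, invertible w /\ star a * a = a * star a * w).
Proof.
move=> /EP_corner[p [x [sp ax]]]; have sax := corner_inverse_star sp ax.
exact: corner_associates (corner_inverseM ax sax) (corner_inverseM sax ax).
Qed.

End CStar.

Theorem theorem4p2 (R : realType) (A : cstarAlgType R) (a : A)
    (a_MP : exists x : A, is_MPinverse a x) :
  [<-> (* i *)     EP a;
       (* ii *)    exists s : A, rann s = [set 0] /\ star a = s * a;
       (* iii *)   exists s1 s2 : A, star a = s1 * a /\ a = s2 * star a;
       (* iv *)    exists u : A, rideal u = [set: A] /\ star a = a * u;
       (* v *)     exists u1 u2 : A, star a = a * u1 /\ a = star a * u2;
       (* vi *)    exists t : A, lann t = [set 0] /\ star a = a * t;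
       (* vii *)   exists x : A, lideal x = [set: A] /\ star a = x * a;
       (* viii *)  exists v : A, invertible v /\ star a * a = v * a * star a;
       (* ix *)    exists v1 : A,
                     rann v1 = [set 0] /\ star a * a = v1 * a * star a;
       (* x *)     exists v2 v3 : A, star a * a = v2 * a * star a
                     /\ a * star a = v3 * star a * a;
       (* xi *)    exists w : A, invertible w /\ star a * a = a * star a * w;
       (* xii *)   exists w1 : A,
                     rideal w1 = [set: A] /\ star a * a = a * star a * w1;
       (* xiii *)  exists w2 w3 : A, star a * a = a * star a * w2
                     /\ a * star a = star a * a * w3;
       (* xiv *)   exists z1 z2 : A, star a * a = a * z1 * star a
                     /\ a * star a = star a * z2 * a;
       (* xv *)    exists h1 : A,
                     invertible h1 /\ star a * a = a * h1 * star h1 * star a;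
       (* xvi *)   exists h2 : A,
                     lann h2 = [set 0] /\ star a * a = a * h2 * star h2 * star a;
       (* xvii *)  exists h3 : A,
                     rideal h3 = [set: A]
                     /\ star a * a = a * h3 * star h3 * star a].
Proof.
have EP_s := @EP_star_associates R A a; have EP_n := @EP_normal_associates R A a.
have rEP := rann_eq_EP a_MP; have lEP := lann_eq_EP a_MP.
have sub1 (y : A) : star a * a * y = 0 <-> a * y = 0 := mul_star_mul_eq0 a y.
have sub2 (y : A) : a * star a * y = 0 <-> star a * y = 0.
  by rewrite -{1}[a]starK; exact: mul_star_mul_eq0.
have sub3 (y : A) : y * (a * star a) = 0 <-> y * a = 0 := mul_mul_star_eq0 a y.
have sub4 (y : A) : y * (star a * a) = 0 <-> y * star a = 0.
  by rewrite -{2}[a]starK; exact: mul_mul_star_eq0.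
tfae.
- by move=> /EP_s[[s [/invertible_rann s0 ->]] _]; exists s.
- move=> [s [/rann0P s0 sa]].
  (* The given [s] is merely left cancellable; EP trades it for an invertible [v], whose inverse
     serves as [s2]. *)
  have /EP_s[[v [[v' [_ v'v]] va]] _] : EP a.
    apply: rEP => y; split=> [ay|]; first by rewrite sa -mulrA ay mulr0.
    by rewrite sa -mulrA => /s0.
  by exists v, v'; rewrite {2}va mulrA v'v mul1r.
- move=> [s1 [s2 [e1 e2]]].
  have /EP_s[_ [w [/invertible_rideal wT wa]]] : EP a.
    apply: rEP => y; split=> ay; first by rewrite e1 -mulrA ay mulr0.
    by rewrite e2 -mulrA ay mulr0.
  by exists w.
- move=> [u [/ridealTP[u' uu'] au]].
  by exists u, u'; rewrite au -mulrA uu' mulr1.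
- move=> [u1 [u2 [e1 e2]]].
  have /EP_s[_ [w [/invertible_lann w0 wa]]] : EP a.
    apply: lEP => y; split=> ya; first by rewrite e1 mulrA ya mul0r.
    by rewrite e2 mulrA ya mul0r.
  by exists w.
- move=> [t [/lann0P t0 ta]].
  have /EP_s[[v [/invertible_lideal vT va]] _] : EP a.
    apply: lEP => y; split=> [ya|]; first by rewrite ta mulrA ya mul0r.
    by rewrite ta mulrA => /t0.
  by exists v.
- move=> [x [/lidealT_rann/rann0P x0 xa]].
  have /EP_n[[v [vi va]] _] : EP a.
    apply: rEP => y; split=> [ay|]; first by rewrite xa -mulrA ay mulr0.
    by rewrite xa -mulrA => /x0.
  by exists v; rewrite -mulrA.
- by move=> [v [/invertible_rann v0 va]]; exists v.
- move=> [v [/rann0P v0 va]].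
  have /EP_n[[w [[w' [_ w'w]] wa]] _] : EP a.
    apply: rEP => y; rewrite -sub1 -sub2 va -!mulrA.
    by split=> [|->]; [exact: v0 | rewrite mulr0].
  by exists w, w'; rewrite -!mulrA; split=> //; rewrite wa mulrA w'w mul1r.
- move=> [v2 [v3 [e1 e2]]].
  have /EP_n[_ //] : EP a.
  apply: rEP => y; rewrite -sub1 -sub2; split=> ay.
    by rewrite e2 -!mulrA (mulrA _ a) ay mulr0.
  by rewrite e1 -!mulrA (mulrA a) ay mulr0.
- by move=> [w [/invertible_rideal wT wa]]; exists w.
- move=> [w [/ridealTP[w' ww'] wa]].
  by exists w, w'; split=> //; rewrite wa -mulrA ww' mulr1.
- move=> [w2 [w3 [e1 e2]]].
  have /EP_s[[v [[v' [_ v'v]] va]] [w [[w' [ww' _]] wa]]] : EP a.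
    apply: lEP => y; rewrite -sub3 -sub4; split=> ay.
      by rewrite e1 mulrA ay mul0r.
    by rewrite e2 mulrA ay mul0r.
  have av : a = v' * star a by rewrite va mulrA v'v mul1r.
  have aw : a = star a * w' by rewrite wa -mulrA ww' mulr1.
  (* Regroup as [(a * w) * (v' * star a)] and [(star a * w') * (v * a)]. *)
  by exists (w * v'), (w' * v); rewrite !mulrA -wa -aw -!mulrA -va -av.
- move=> [z1 [z2 [e1 e2]]].
  have /EP_s[_ [w [wi wa]]] : EP a.
    apply: lEP => y; split=> ya.
      by apply/sub4; rewrite e1 !mulrA ya !mul0r.
    by apply/sub3; rewrite e2 !mulrA ya !mul0r.
  (* With [star a = a * w], the right-hand side is [(a * w) * star (a * w)]. *)
  by exists w; split=> //; rewrite -mulrA -starM -wa starK.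
- by move=> [h [/invertible_lann h0 ha]]; exists h.
- move=> [h [/lann0P h0 ha]].
  have /EP_s[_ [w [/invertible_rideal wT wa]]] : EP a.
    (* Since [star a * a] is [(a * h) * star (a * h)], [y] kills [star a] iff it kills [a * h], and
       [h] cancels on the right. *)
    apply: lEP => y; rewrite -sub4 ha -(mulrA _ _ (star a)) -starM mul_mul_star_eq0.
    by split=> [ya|]; [rewrite mulrA ya mul0r | rewrite mulrA => /h0].
  by exists w; split=> //; rewrite -mulrA -starM -wa starK.
- move=> [h [/ridealT_lann/lann0P h0 ha]].
  apply: lEP => y; rewrite -sub4 ha -(mulrA _ _ (star a)) -starM mul_mul_star_eq0.
  by split=> [ya|]; [rewrite mulrA ya mul0r | rewrite mulrA => /h0].
Qed.
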